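(* Let $\Phi$ be an associative commutative ring with $1$ and let $A$ be a finitely generated associative commutative $\Phi$-algebra. Suppose that $A$ does not have additive torsion. Then every torsion subgroup of $\mathrm{Aut}(A)$ is locally finite.
   Context: Algebras are taken with $1$. ''Finitely generated'' means finitely generated as a $\Phi$-algebra. $\mathrm{Aut}(A)$ is the group of $\Phi$-linear algebra automorphisms of $A$. $A$ does not have additive torsion if $na=0$ with $a\in A$ and an integer $n\ge 1$ implies $a=0$. A group is torsion if all its elements have finite order, and locally finite if every finitely generated subgroup is finite. *)

(* Defs.v *)
From HB Require Import structures.
From mathcomp Require Import all_boot all_algebra.
From mathcomp Require Import boolp classical_sets functions cardinality.

Set Implicit Arguments.
Unset Strict Implicit.
Unset Printing Implicit Defensive.

Import GRing.Theory.
Local Open Scope classical_set_scope.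
Local Open Scope ring_scope.

(* Commutative associative unital algebras over Phi. The library's
   [comAlgType Phi] requires 1 != 0; this structure also admits the zero
   algebra. [comAlg_of] embeds [comAlgType Phi] into it. *)
Record comAlg (Phi : comPzRingType) := ComAlg {
  alg_ring : comPzRingType;
  alg_scale : Phi -> alg_ring -> alg_ring;
  alg_scaleA : forall a b u, alg_scale a (alg_scale b u) = alg_scale (a * b) u;
  alg_scale1 : left_id 1 alg_scale;
  alg_scaleDr : right_distributive alg_scale +%R;
  alg_scaleDl : forall u, {morph alg_scale^~ u : a b / a + b >-> a + b};
  alg_scaleAl : forall a u v, alg_scale a (u * v) = alg_scale a u * v
}.

Definition alg_sort (Phi : comPzRingType) (A : comAlg Phi) : Type := alg_ring A.
Coercion alg_sort : comAlg >-> Sortclass.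

HB.instance Definition _ (Phi : comPzRingType) (A : comAlg Phi) :=
  GRing.ComPzRing.copy (alg_sort A) (alg_ring A).
HB.instance Definition _ (Phi : comPzRingType) (A : comAlg Phi) :=
  GRing.Zmodule_isLmodule.Build Phi (alg_sort A)
    (@alg_scaleA Phi A) (@alg_scale1 Phi A) (@alg_scaleDr Phi A)
    (@alg_scaleDl Phi A).

Definition comAlg_of (Phi : comPzRingType) (A : comAlgType Phi) : comAlg Phi :=
  @ComAlg Phi A *:%R (@scalerA Phi A) (@scale1r Phi A) (@scalerDr Phi A)
    (@scalerDl Phi A) (@scalerAl Phi A).

Section Algebra.
Variables (Phi : comPzRingType) (A : comAlg Phi).

Definition subalgebra (B : set A) : Prop :=
  [/\ B 1,
      forall (c : Phi) u v, B u -> B v -> B (c *: u + v) &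
      forall u v, B u -> B v -> B (u * v)].

Definition finitely_generated_alg : Prop :=
  exists s : seq A, smallest subalgebra [set` s] = [set: A].

Definition no_additive_torsion : Prop :=
  forall (n : nat) (a : A), (0 < n)%N -> a *+ n = 0 -> a = 0.

Record algAut := AlgAut {
  aut_fun :> A -> A;
  aut_linear : linear aut_fun;
  aut_monoid : monoid_morphism aut_fun;
  aut_bij : bijective aut_fun
}.

Lemma algAut_ext (f g : algAut) : f =1 g -> f = g.
Proof.
case: f g => [f lf mf bf] [g lg mg bg] /= /funext efg.
by case: _ / efg lg mg bg => *; congr AlgAut; apply: Prop_irrelevance.
Qed.

HB.instance Definition _ := gen_eqMixin algAut.
HB.instance Definition _ := gen_choiceMixin algAut.

Definition algAut_one : algAut.
Proof. by exists id => //; exists id. Defined.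

Definition algAut_mul (f g : algAut) : algAut.
Proof.
exists (f \o g).
- by move=> c u v; rewrite /= !aut_linear.
- have [[f1 fM] [g1 gM]] := (aut_monoid f, aut_monoid g).
  by split=> [|u v]; rewrite /= ?g1 ?gM.
- exact: bij_comp (aut_bij f) (aut_bij g).
Defined.

Lemma algAut_invP (f : algAut) :
  exists g : algAut, cancel f g /\ cancel g f.
Proof.
have [g fK gK] := aut_bij f; have [f1 fM] := aut_monoid f.
have gl : linear g.
  by move=> c u v; rewrite -{1}[u]gK -{1}[v]gK -aut_linear fK.
have gm : monoid_morphism g.
  split=> [|u v]; first by rewrite -f1 fK.
  by rewrite -{1}[u]gK -{1}[v]gK -fM fK.
by exists (AlgAut gl gm (Bijective gK fK)).
Qed.

Definition algAut_inv (f : algAut) : algAut := sval (cid (algAut_invP f)).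

Lemma algAut_mulA : associative algAut_mul.
Proof. by move=> f g h; apply: algAut_ext. Qed.

Lemma algAut_mul1 : left_id algAut_one algAut_mul.
Proof. by move=> f; apply: algAut_ext. Qed.

Lemma algAut_mulr1 : right_id algAut_one algAut_mul.
Proof. by move=> f; apply: algAut_ext. Qed.

Lemma algAut_mulV : left_inverse algAut_one algAut_inv algAut_mul.
Proof.
move=> f; apply: algAut_ext => u /=.
by rewrite /algAut_inv; case: cid => g [/= fK _]; rewrite fK.
Qed.

Lemma algAut_mulrV : right_inverse algAut_one algAut_inv algAut_mul.
Proof.
move=> f; apply: algAut_ext => u /=.
by rewrite /algAut_inv; case: cid => g [/= _ gK]; rewrite gK.
Qed.

HB.instance Definition _ := isGroup.Build algAut
  algAut_mulA algAut_mul1 algAut_mulr1 algAut_mulV algAut_mulrV.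

End Algebra.

Section Groups.
Variable G : groupType.
Local Open Scope group_scope.

Definition subgroup (H : set G) : Prop :=
  [/\ H 1, forall x y, H x -> H y -> H (x * y) & forall x, H x -> H x^-1].

Definition torsion (H : set G) : Prop :=
  forall x, H x -> exists2 n : nat, (0 < n)%N & x ^+ n = 1.

Definition finitely_generated_group (K : set G) : Prop :=
  exists s : seq G, K = smallest subgroup [set` s].

Definition locally_finite (H : set G) : Prop :=
  forall K : set G, subgroup K -> K `<=` H -> finitely_generated_group K ->
  finite_set K.

End Groups.

(* Main.v *)
Require Import Defs.
From HB Require Import structures.
From mathcomp Require Import all_boot all_order all_algebra all_field.
From mathcomp Require Import ring zify.
From mathcomp Require Import boolp classical_sets cardinality.

(** Why the theorem is true.

    Let G be a finitely generated subgroup of the torsion group H. Add to a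
    finite generating set of the algebra A the finitely many scalars that occur
    when the generators of G are applied to it; the subring B generated by the
    result is stable under G, is finitely generated as a ring, and G acts
    faithfully on it because the elements of G are Phi-linear. So Phi
    disappears, and G becomes a set of ring endomorphisms of finite order of a
    finitely generated torsion-free commutative ring B.

    For such a B there is an ideal of finite index such that an endomorphism of
    finite order which is congruent to the identity modulo this ideal is the
    identity ([torsion_congruence_trivial]). Then G is finite: two elements of G
    that agree modulo the ideal on the generators of B are equal
    ([finite_torsion_action]).

    To find the ideal, consider first any ideal J containing a prime number p,
    and an endomorphism g of order n prime to p with (g - 1)B inside J^2. Let D
    be the ideal generated by (g - 1)B. Modulo JD the iterates of g grow
    linearly, g^k = 1 + k(g - 1), so g^n = 1 gives n D <= JD, and D = JD because
    p lies in J. By Nakayama's lemma some 1 - j with j in J annihilates D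
    ([coprime_order_congr]). If g has arbitrary finite order, use ideals J and K
    containing two different primes p and q, and split g into its p-part and the
    part of order prime to p: then g - 1 is annihilated by some product
    (1 - j)(1 - k). As B is noetherian, one product serves all g of finite order
    that are congruent to 1 modulo J^2 and K^2
    ([torsion_congruence_annihilated]).

    Now let N be the set of those x that annihilate (g - 1)B for all g of
    finite order congruent to 1 modulo some ideal of finite index depending on
    x. It is an ideal, and the claim is that 1 lies in N. As B is torsion-free,
    N otherwise contains no positive integer, hence lies in a prime ideal P
    with the same property. By the Nullstellensatz over the integers (B/P has
    points over finite fields of almost every characteristic,
    [has_residue_fields]) there are proper ideals J and K of finite index
    containing P, over two different primes. The product (1 - j)(1 - k) found
    above lies in N, hence in P, so that 1 - j lies in J or 1 - k lies in K,
    which is absurd ([exists_residue_ideals]). *)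

Set Implicit Arguments.
Unset Strict Implicit.
Unset Printing Implicit Defensive.

Import Order.TTheory GRing.Theory Num.Theory.
Local Open Scope classical_set_scope.
Local Open Scope ring_scope.

(** * Ideals and subrings of a commutative ring *)

Section Ideals.
Variable R : comPzRingType.
Implicit Types (I J N P M S : set R) (s : seq R).

Definition ideal I : Prop :=
  [/\ I 0, forall x y, I x -> I y -> I (x + y) & forall a x, I x -> I (a * x)].

Definition prime_ideal P : Prop :=
  [/\ ideal P, ~ P 1 & forall x y, P (x * y) -> P x \/ P y].

Definition mul_ideal I J : set R :=
  smallest ideal [set z | exists x y, [/\ I x, J y & z = x * y]].

Definition noetherian : Prop :=
  forall I, ideal I -> exists s, I = smallest ideal [set` s].

(** Finitely many colours, such that elements of the same colour are congruent
    modulo I; this avoids the quotient ring. *)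
Definition finite_index I : Prop :=
  exists (F : finType) (c : R -> F), forall x y, c x = c y -> I (x - y).

Lemma ideal_opp I x : ideal I -> I x -> I (- x).
Proof. by case=> _ _ IM Ix; rewrite -mulN1r; apply: IM. Qed.

Lemma ideal_sub I x y : ideal I -> I x -> I y -> I (x - y).
Proof.
by move=> idI Ix Iy; case: (idI) => _ ID _; apply: ID => //; apply: ideal_opp.
Qed.

Lemma ideal_mull I a x : ideal I -> I x -> I (a * x).
Proof. by case=> _ _; apply. Qed.

Lemma ideal_mulr I a x : ideal I -> I x -> I (x * a).
Proof. by rewrite mulrC; apply: ideal_mull. Qed.

Lemma ideal_add I x y : ideal I -> I x -> I y -> I (x + y).
Proof. by case=> _ + _; apply. Qed.

Lemma ideal_muln I x n : ideal I -> I x -> I (x *+ n).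
Proof. by move=> idI Ix; rewrite -mulr_natl; apply: ideal_mull. Qed.

Lemma ideal_smallest S : ideal (smallest ideal S).
Proof.
split=> [I [[I0 _ _] _] //|x y Sx Sy I SI|a x Sx I SI].
  by have [idI _] := SI; apply: ideal_add => //; [exact: Sx | exact: Sy].
by have [idI _] := SI; apply: ideal_mull => //; exact: Sx.
Qed.
#[local] Hint Resolve ideal_smallest : core.

Lemma ideal_setI I J : ideal I -> ideal J -> ideal (I `&` J).
Proof.
move=> [I0 ID IM] [J0 JD JM]; split=> // [x y [? ?] [? ?]|a x [? ?]].
  by split; auto.
by split; auto.
Qed.

Lemma smallest_ideal_mono S S' x :
  S `<=` S' -> smallest ideal S x -> smallest ideal S' x.
Proof.
move=> SS'; apply: smallest_sub => // y Sy.
by apply: sub_gen_smallest; apply: SS'.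
Qed.

Lemma mul_idealP I J x y : I x -> J y -> mul_ideal I J (x * y).
Proof. by move=> Ix Jy; apply: sub_gen_smallest; exists x, y. Qed.

Lemma ideal_mul I J : ideal (mul_ideal I J).
Proof. exact: ideal_smallest. Qed.

Lemma mul_ideal_subl I J x : ideal I -> mul_ideal I J x -> I x.
Proof.
by move=> idI; apply: smallest_sub => // _ [a [b [Ia _ ->]]]; apply: ideal_mulr.
Qed.

Lemma mul_ideal_subr I J x : ideal J -> mul_ideal I J x -> J x.
Proof.
by move=> idI; apply: smallest_sub => // _ [a [b [_ Jb ->]]]; apply: ideal_mull.
Qed.

Lemma coprime_ideal I m n x : ideal I -> (0 < m)%N -> coprime m n ->
  I (x *+ m) -> I (x *+ n) -> I x.
Proof.
move=> idI m_gt0; move=> /(coprimeP _ m_gt0)[[u v] /= uv1] Im In.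
have -> : x = x *+ m *+ u - x *+ n *+ v.
  rewrite -!mulrnA -mulrnBr ?[(m * u)%N]mulnC ?[(n * v)%N]mulnC; last by lia.
  by rewrite uv1.
by apply: ideal_sub => //; apply: ideal_muln.
Qed.

Lemma smallest_ideal_nil x : smallest ideal [set` [::]] x -> x = 0.
Proof.
move=> /(_ [set 0]); apply; split=> [|y //].
by split=> // [x0 y -> ->|a y ->]; rewrite /= ?addr0 ?mulr0.
Qed.

Lemma smallest_ideal_cons x s z : smallest ideal [set` x :: s] z ->
  exists a, smallest ideal [set` s] (z - a * x).
Proof.
move=> /(_ [set z | exists a, smallest ideal [set` s] (z - a * x)]).
apply; split; last first.
  move=> y /=; rewrite inE => /predU1P[->|ys].
    by exists 1; rewrite mul1r subrr; case: (ideal_smallest [set` s]).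
  by exists 0; rewrite mul0r subr0; apply: sub_gen_smallest.
split=> [|y t [a Ia] [b Ib]|b y [a Ia]].
- by exists 0; rewrite mul0r subr0; case: (ideal_smallest [set` s]).
- exists (a + b); have := ideal_add (ideal_smallest _) Ia Ib.
  by congr (smallest ideal _ _); ring.
exists (b * a); have := ideal_mull b (ideal_smallest _) Ia.
by congr (smallest ideal _ _); ring.
Qed.

Lemma mul_ideal_cons J x s z : ideal J ->
  mul_ideal J (smallest ideal [set` x :: s]) z ->
  exists2 j, J j & mul_ideal J (smallest ideal [set` s]) (z - j * x).
Proof.
move=> idJ; pose E := mul_ideal J (smallest ideal [set` s]).
have idE : ideal E by apply: ideal_mul.
move=> /(_ [set z | exists2 j, J j & E (z - j * x)]).
apply; split; last first.
  move=> _ [j [y [Jj /smallest_ideal_cons[a Ia] ->]]] /=.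
  exists (j * a); first exact: ideal_mulr.
  by have := mul_idealP Jj Ia; congr (E _); ring.
have [J0 _ _] := idJ; have [E0 _ _] := idE.
split=> [|y t [a Ja Ia] [b Jb Ib]|b y [a Ja Ia]].
- by exists 0; rewrite // mul0r subr0.
- exists (a + b); first exact: ideal_add.
  by have := ideal_add idE Ia Ib; congr (E _); ring.
exists (b * a); first exact: ideal_mull.
by have := ideal_mull b idE Ia; congr (E _); ring.
Qed.

(** Induction on the number of generators, in place of the determinant trick:
    if c is 1 modulo J and maps D = (x, s) into JD, then c x = j x modulo
    J(s), so that (c - j) x lies in J(s). After multiplication by c - j the
    generator x is superfluous. The usual statement is the case c = 1; the
    induction needs the general one. *)
Lemma nakayama J s c : ideal J -> J (1 - c) ->
  (forall z, smallest ideal [set` s] z ->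
     mul_ideal J (smallest ideal [set` s]) (c * z)) ->
  exists2 e, J (1 - e) & forall z, smallest ideal [set` s] z -> e * z = 0.
Proof.
move=> idJ; elim: s c => [|x s IHs] c Jc sJ.
  by exists c => // z /smallest_ideal_nil ->; rewrite mulr0.
pose E := mul_ideal J (smallest ideal [set` s]).
have idE : ideal E by apply: ideal_mul.
have xs : smallest ideal [set` x :: s] x.
  by apply: sub_gen_smallest => /=; rewrite inE eqxx.
have sub z : smallest ideal [set` s] z -> smallest ideal [set` x :: s] z.
  by apply: smallest_ideal_mono => y /= ys; rewrite inE ys orbT.
have [j Jj Ej] := mul_ideal_cons idJ (sJ _ xs).
pose d := c - j.
have Ed : E (d * x) by rewrite mulrBl.
have Jd : J (1 - d).
  by have := ideal_add idJ Jc Jj; congr (J _); rewrite /d; ring.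
have [||e Je es0] := IHs (d * c).
- have := ideal_add idJ Jd (ideal_mull d idJ Jc); congr (J _); ring.
- move=> z /sub/sJ /(mul_ideal_cons idJ)[i Ji Ei].
  have := ideal_add idE (ideal_mull d idE Ei) (ideal_mull i idE Ed).
  by congr (E _); ring.
exists (e * d).
  have := ideal_add idJ Je (ideal_mull e idJ Jd); congr (J _); ring.
move=> z /smallest_ideal_cons[a /es0 za].
have edx : e * (d * x) = 0 by apply: es0; apply: mul_ideal_subr Ed.
rewrite -[z](subrK (a * x)) mulrDr mulrAC za mul0r add0r.
by rewrite mulrCA -mulrA edx mulr0.
Qed.

Lemma finite_index_setI I J :
  finite_index I -> finite_index J -> finite_index (I `&` J).
Proof.
move=> [F [c cP]] [G [d dP]]; exists (F * G)%type, (fun x => (c x, d x)).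
by move=> x y [/cP ? /dP].
Qed.

(** B/J being finite, so is D/JD for every finitely generated ideal D: it is a
    finitely generated module over B/J. *)
Lemma finite_index_mul J s : finite_index J -> ideal J ->
  exists (F : finType) (c : R -> F), forall x y,
    smallest ideal [set` s] x -> smallest ideal [set` s] y -> c x = c y ->
    mul_ideal J (smallest ideal [set` s]) (x - y).
Proof.
move=> [F [c cP]] idJ; elim: s => [|x s [G [d dP]]].
  exists unit, (fun=> tt) => x y /smallest_ideal_nil -> /smallest_ideal_nil -> _.
  by rewrite subrr; case: (ideal_mul J (smallest ideal [set` [::]])).
have /choice[a aP] z : exists a, smallest ideal [set` x :: s] z ->
    smallest ideal [set` s] (z - a * x).
  have [|nz] := pselect (smallest ideal [set` x :: s] z).
    move=> /smallest_ideal_cons[a ?].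
    by exists a.
  by exists 0.
exists (F * G)%type, (fun z => (c (a z), d (z - a z * x))) => y z.
move=> /aP ys /aP zs [/cP ca /(dP _ _ ys zs) dyz].
pose E := mul_ideal J (smallest ideal [set` x :: s]).
have idE : ideal E by apply: ideal_mul.
have E1 : E ((a y - a z) * x).
  by apply: mul_idealP => //; apply: sub_gen_smallest => /=; rewrite inE eqxx.
suff /(ideal_add idE E1) : E (y - a y * x - (z - a z * x)).
  by congr (E _); ring.
apply: smallest_ideal_mono dyz => _ [u [v [Ju sv ->]]].
exists u, v; split=> //.
by apply: smallest_ideal_mono sv => t /= ts; rewrite inE ts orbT.
Qed.

Lemma finite_index_sqr J : noetherian -> ideal J -> finite_index J ->
  finite_index (mul_ideal J J).
Proof.
move=> noethR idJ fiJ; have [s Js] := noethR _ idJ.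
have [G [d dP]] := finite_index_mul s fiJ idJ; rewrite -Js in dP.
case: fiJ => F [c cP].
have /choice[r rP] (k : F) : exists r, forall x, c x = k -> c x = c r.
  have [[x cx]|nk] := pselect (exists x, c x = k).
    by exists x; rewrite cx.
  by exists 0 => x cx; case: nk; exists x.
exists (F * G)%type, (fun x => (c x, d (x - r (c x)))) => x y [cxy dxy].
have Jr z : J (z - r (c z)) by apply/cP/rP.
have := dP _ _ (Jr x) (Jr y) dxy.
by rewrite cxy; congr (mul_ideal J J _); ring.
Qed.

(** An ideal that is maximal among those disjoint from a multiplicative set is
    prime. *)
Lemma exists_prime_ideal N M : ideal N -> M 1 ->
    (forall x y, M x -> M y -> M (x * y)) -> (forall x, N x -> ~ M x) ->
  exists P, [/\ prime_ideal P, N `<=` P & forall x, P x -> ~ M x].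
Proof.
move=> idN M1 MM NM.
pose good X := [/\ ideal X, N `<=` X & forall x, X x -> ~ M x].
(* The empty set is allowed because it is the union of the empty chain. *)
have [F Fgood Ftot|A [Agood Amax]] :=
  @Zorn_bigcup _ [set X | X = set0 \/ good X].
  have [F0|] := pselect (forall X, F X -> X = set0).
    left; rewrite -subset0 => x [X FX]; rewrite (F0 _ FX) //.
  move=> /existsNP[X0 /not_implyP[FX0 X0n0]]; right.
  have gF X x : F X -> X x -> good X.
    by move=> /Fgood[-> //|].
  have [[X00 _ _] NX0 _] : good X0 by case: (Fgood _ FX0).
  split=> [|x /NX0 X0x|x [X FX Xx]]; last 2 first.
  - by exists X0.
  - by have [_ _ /(_ _ Xx)] := gF _ _ FX Xx.
  split=> [|x y [X FX Xx] [Y FY Yy]|a x [X FX Xx]].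
  - by exists X0.
  - have [XY|YX] := Ftot _ _ FX FY.
      exists Y => //; have [idY _ _] := gF _ _ FY Yy.
      by apply: ideal_add => //; apply: XY.
    exists X => //; have [idX _ _] := gF _ _ FX Xx.
    by apply: ideal_add => //; apply: YX.
  exists X => //; have [idX _ _] := gF _ _ FX Xx.
  exact: ideal_mull.
have {Agood} [idA NA AM] : good A.
  case: Agood => // A0; exfalso; apply: (Amax N); last by right; split.
  split; first by rewrite A0.
  by move=> /(_ 0); rewrite A0; apply; case: idN.
have grow x : ~ A x -> exists a r, A a /\ M (a + r * x).
  move=> nAx; apply: contrapT => nM.
  pose Y := [set z | exists2 r, True & A (z - r * x)].
  have AY : A `<=` Y by move=> z Az; exists 0; rewrite // mul0r subr0.
  have [A0 _ _] := idA.
  apply: (Amax Y).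
    split=> //; move=> /(_ x) YA; apply/nAx/YA.
    by exists 1; rewrite // mul1r subrr.
  right; split=> [|z /NA/AY //|z [r _ Az] Mz]; last first.
    by apply: nM; exists (z - r * x), r; split; rewrite ?subrK.
  split; first exact: AY.
    move=> y z [r _ Ay] [t _ Az]; exists (r + t) => //.
    by have := ideal_add idA Ay Az; congr (A _); ring.
  move=> b z [r _ Az]; exists (b * r) => //.
  by have := ideal_mull b idA Az; congr (A _); ring.
exists A; split=> //; split=> // [A1|x y Axy]; first exact: (AM 1).
apply: contrapT => /not_orP[/grow[a [r [Aa Mx]]] /grow[b [t [Ab My]]]].
apply: (AM _ _ (MM _ _ Mx My)).
have := ideal_add idA (ideal_mulr (b + t * y) idA Aa)
  (ideal_add idA (ideal_mull (r * x) idA Ab) (ideal_mull (r * t) idA Axy)).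
by congr (A _); ring.
Qed.

End Ideals.

Arguments ideal {R} I.
Arguments noetherian R : clear implicits.

Section Subrings.
Variable R : comPzRingType.
Implicit Types (C S : set R).

Definition subring C : Prop :=
  [/\ C 1, forall x y, C x -> C y -> C (x - y) &
      forall x y, C x -> C y -> C (x * y)].

Lemma smallest_subring S : subring (smallest subring S).
Proof.
split=> [C [[C1 _ _] _] //|x y Sx Sy C SC|x y Sx Sy C SC].
  by have [[_ CB _] _] := SC; apply: CB; [exact: Sx | exact: Sy].
by have [[_ _ CM] _] := SC; apply: CM; [exact: Sx | exact: Sy].
Qed.

Lemma smallest_subring_mono S S' x :
  S `<=` S' -> smallest subring S x -> smallest subring S' x.
Proof.
move=> SS'; apply: smallest_sub => [|y /SS'].
  exact: smallest_subring.
exact: sub_gen_smallest.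
Qed.

Lemma subringD C x y : subring C -> C x -> C y -> C (x + y).
Proof.
case=> C1 CB _ Cx Cy; rewrite -[y]opprK; apply: (CB) => //.
by rewrite -sub0r; apply: (CB) => //; rewrite -(subrr 1); apply: CB.
Qed.

End Subrings.

Arguments subring {R} C.

(** * Hilbert's basis theorem *)

Section HilbertBasis.
Variable R : comNzRingType.

(** The leading coefficients of the elements of I of degree n, together with
    0. *)
Definition coef_ideal (I : set {poly R}) n : set R :=
  [set r | exists p, [/\ I p, (size p <= n.+1)%N & p`_n = r]].

Lemma ideal_coef I n : ideal I -> ideal (coef_ideal I n).
Proof.
move=> idI; split=> [|_ _ [p [Ip sp <-]] [q [Iq sq <-]]|a _ [p [Ip sp <-]]].
- by exists 0; rewrite size_poly0 coef0; split=> //; case: idI.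
- exists (p + q); rewrite coefD; split=> //; first exact: ideal_add.
  by rewrite (leq_trans (size_polyD _ _)) // geq_max sp.
exists (a *: p); rewrite coefZ -mul_polyC; split=> //; first exact: ideal_mull.
by rewrite mul_polyC (leq_trans (size_scale_leq _ _)).
Qed.

Lemma coef_ideal_le I m n :
  ideal I -> (m <= n)%N -> coef_ideal I m `<=` coef_ideal I n.
Proof.
move=> idI le_mn _ [p [Ip sp <-]]; exists (p * 'X^(n - m)).
rewrite coefMXn ltnNge leq_subr subKn //; split=> //; first exact: ideal_mulr.
rewrite (leq_trans (size_polyMleq _ _)) // size_polyXn addnS /=.
by rewrite -{2}(subnK le_mn) addnC -addnS leq_add2l.
Qed.

Lemma coef_ideal_lift I n : noetherian R -> ideal I -> exists s : seq {poly R},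
  [set` s] `<=` I /\ coef_ideal I n `<=` coef_ideal (smallest ideal [set` s]) n.
Proof.
move=> noethR idI; have [s Is] := noethR _ (ideal_coef n idI).
suff [t [tI st]] : exists t : seq {poly R}, [set` t] `<=` I /\
    [set` s] `<=` coef_ideal (smallest ideal [set` t]) n.
  exists t; split=> //; rewrite Is; apply: smallest_sub => //.
  by apply: ideal_coef; apply: ideal_smallest.
have : [set` s] `<=` coef_ideal I n by rewrite Is; apply: sub_gen_smallest.
elim: s {Is} => [|x s IHs] sI; first by exists [::]; split=> y.
have [|t [tI st]] := IHs.
  by move=> y ys; apply: sI; rewrite /= inE ys orbT.
have [|p [Ip sp px]] := sI x; first by rewrite /= inE eqxx.
exists (p :: t); split=> y /=; rewrite inE => /predU1P[->//|]; first exact: tI.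
  exists p; split=> //; apply: sub_gen_smallest; rewrite /= inE eqxx //.
move=> /st [q [tq sq qy]]; exists q; split=> //.
by apply: smallest_ideal_mono tq => z /= zt; rewrite inE zt orbT.
Qed.

Lemma coef_ideal_lifts I d : noetherian R -> ideal I -> exists s : seq {poly R},
  [set` s] `<=` I /\ forall n, (n <= d)%N ->
    coef_ideal I n `<=` coef_ideal (smallest ideal [set` s]) n.
Proof.
move=> noethR idI; elim: d => [|d [s [sI ds]]].
  have [s [sI ds]] := coef_ideal_lift 0 noethR idI.
  by exists s; split=> // n; rewrite leqn0 => /eqP->.
have [t [tI dt]] := coef_ideal_lift d.+1 noethR idI.
exists (s ++ t); split=> [x|n].
  by rewrite /= mem_cat => /orP[/sI|/tI].
have sub (J J' : set {poly R}) k :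
    J `<=` J' -> coef_ideal J k `<=` coef_ideal J' k.
  by move=> JJ' _ [p [/JJ' Jp sp <-]]; exists p.
rewrite leq_eqVlt => /predU1P[->|/ds dn].
  apply: (subset_trans dt); apply: sub => x; apply: smallest_ideal_mono => y /=.
  by rewrite mem_cat => ->; rewrite orbT.
apply: (subset_trans dn); apply: sub => x; apply: smallest_ideal_mono => y /=.
by rewrite mem_cat => ->.
Qed.

(** The ideals of leading coefficients increase with the degree, so they are
    constant from some degree d on. Finitely many elements of I produce all
    leading coefficients in the degrees up to d, hence in all degrees, and an
    element of I is reduced to 0 by subtracting combinations of these. *)
Lemma noetherian_poly : noetherian R -> noetherian {poly R}.
Proof.
move=> noethR I idI.
pose L := [set r | exists n, coef_ideal I n r].
have idL : ideal L.
  split=> [|x y [m mx] [n ny]|a x [m mx]].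
  - by exists 0; case: (ideal_coef 0 idI).
  - exists (maxn m n); apply: (ideal_add (ideal_coef _ idI)).
      by apply: coef_ideal_le mx; rewrite // leq_maxl.
    by apply: coef_ideal_le ny; rewrite // leq_maxr.
  by exists m; apply: ideal_mull => //; apply: ideal_coef.
have [xs Lxs] := noethR _ idL.
have [d Ld] : exists d, L `<=` coef_ideal I d.
  suff [d xsd] : exists d, [set` xs] `<=` coef_ideal I d.
    by exists d; rewrite Lxs; apply: smallest_sub => //; apply: ideal_coef.
  have : [set` xs] `<=` L by rewrite Lxs; apply: sub_gen_smallest.
  elim: xs {Lxs} => [|x xs IHxs] xsL; first by exists 0 => y.
  have [|d xsd] := IHxs.
    by move=> y ys; apply: xsL; rewrite /= inE ys orbT.
  have [|n nx] := xsL x; first by rewrite /= inE eqxx.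
  exists (maxn n d) => y /=; rewrite inE => /predU1P[->|/xsd yd].
    by apply: coef_ideal_le nx; rewrite // leq_maxl.
  by apply: coef_ideal_le yd; rewrite // leq_maxr.
have [s [sI ds]] := coef_ideal_lifts d noethR idI.
exists s; apply/seteqP; split=> [p Ip|]; last exact: (smallest_sub idI sI).
move: {2}(size p) (leqnn (size p)) => n.
have idG : ideal (smallest ideal [set` s]) by apply: ideal_smallest.
elim: n p Ip => [|n IHn] p Ip.
  by rewrite leqn0 size_poly_eq0 => /eqP->; case: idG.
move=> sp; suff [q [Gq sq qp]] : coef_ideal (smallest ideal [set` s]) n p`_n.
  have Iq : I q by move: q Gq {sq qp}; apply: smallest_sub.
  rewrite -(subrK q p); apply: (ideal_add idG) => //.
  apply: IHn; first exact: ideal_sub.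
  apply/leq_sizeP => j; rewrite leq_eqVlt => /predU1P[<-|ltnj].
    by rewrite coefB qp subrr.
  by rewrite coefB !nth_default ?subrr // (leq_trans _ ltnj).
have pn : coef_ideal I n p`_n by exists p.
have [le_nd|lt_dn] := leqP n d; first exact: ds.
apply: (coef_ideal_le idG (ltnW lt_dn)); apply: ds => //.
by apply: Ld; exists n.
Qed.

End HilbertBasis.

Lemma noetherian_int : noetherian int.
Proof.
move=> I idI; have [I0 _ _] := idI.
have [I_0|] := pselect (I `<=` [set 0]).
  exists [::]; apply/seteqP; split=> x; last by move=> /smallest_ideal_nil->.
  by move=> /I_0->; case: (ideal_smallest [set` [::] : seq int]).
move=> /existsNP[x /not_implyP[Ix /eqP x0]].
have Pex : exists n : nat, `[< (0 < n)%N /\ I n%:Z >].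
  exists `|x|%N; apply/asboolP; split; first by rewrite absz_gt0.
  by rewrite abszEsg; apply: ideal_mull.
case: (ex_minnP Pex) => n /asboolP[n_gt0 In] nmin.
exists [:: n%:Z]; apply/seteqP; split=> [y Iy|]; last first.
  by apply: smallest_sub => // y; rewrite /= inE => /eqP->.
have n0 : n%:Z != 0 by rewrite -lt0n.
have ymod : (y %% n%:Z)%Z = 0.
  apply/eqP/negPn/negP => ym0.
  have Im : I (y %% n%:Z)%Z.
    by rewrite /modz; apply: ideal_sub => //; apply: ideal_mull.
  have /nmin : `[< (0 < `|(y %% n%:Z)%Z|)%N /\ I `|(y %% n%:Z)%Z|%N%:Z >].
    by apply/asboolP; rewrite absz_gt0 gez0_abs ?modz_ge0.
  by rewrite -lez_nat gez0_abs ?modz_ge0 // leNgt ltz_pmod.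
rewrite (divz_eq y n%:Z) ymod addr0; apply: (ideal_mull _ (ideal_smallest _)).
by apply: sub_gen_smallest; rewrite /= inE.
Qed.

Lemma noetherian_image (R B : comPzRingType) (f : {rmorphism R -> B}) :
  noetherian R -> (forall b, exists x, f x = b) -> noetherian B.
Proof.
move=> noethR fsurj I idI; pose I' := [set x | I (f x)].
have idI' : ideal I'.
  have [I0 ID IM] := idI.
  split=> [|x y|a x]; rewrite /I' /= ?rmorph0 ?rmorphD ?rmorphM //.
    exact: ID.
  exact: IM.
have [s Is] := noethR _ idI'.
exists (map f s); apply/seteqP; split=> b.
  have [x <-] := fsurj b => Ifx; have : I' x by [].
  rewrite Is; move: x {Ifx}; apply: smallest_sub.
    have [S0 SD SM] := ideal_smallest [set` map f s].
    split=> [|x y|a x]; rewrite /= ?rmorph0 ?rmorphD ?rmorphM //.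
      exact: SD.
    exact: SM.
  by move=> x xs; apply: sub_gen_smallest; apply: map_f.
move: b; apply: smallest_sub => // b /= /mapP[x xs ->].
by have : I' x by rewrite Is; apply: sub_gen_smallest.
Qed.

(** * Points over finite fields *)

Lemma root_finite_extension (F : finFieldType) (q : {poly F}) :
  (1 < size q)%N ->
  exists (F' : finFieldType) (iota : {rmorphism F -> F'}) (w : F'),
    root (map_poly iota q) w.
Proof.
move=> sq; have q0 : q != 0 by rewrite -size_poly_gt0 (leq_trans _ sq).
have [L [zs qzs _]] := FinSplittingFieldFor q0.
have : (1 < size (map_poly (in_alg L) q))%N by rewrite size_map_poly.
rewrite (eqp_size qzs) size_prod_XsubC; case: zs qzs => // w zs qzs _.
exists (FinFieldExtType L), (in_alg L), w.
by rewrite (eqp_root qzs) root_prod_XsubC inE eqxx.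
Qed.

(** The form of the Nullstellensatz that passes from R to R[X]: outside the
    zero locus of c, the subscheme defined by P has points over finite fields
    of almost every characteristic. The induction on the number of variables
    needs an arbitrary c, the applications have c = 1. *)
Definition has_residue_fields (R : comNzRingType) : Prop :=
  forall (P : set R) (c : R), prime_ideal P -> ~ P c ->
    (forall n, (0 < n)%N -> ~ P n%:R) ->
  exists2 N, (0 < N)%N & forall p, prime p -> ~~ (p %| N)%N ->
    exists (F : finFieldType) (psi : {rmorphism R -> F}),
      [/\ p%:R = 0 :> F, forall x, P x -> psi x = 0 & psi c != 0].

Lemma has_residue_fields_int : has_residue_fields int.
Proof.
move=> P c [[P0 _ PM] _ _] Pc Pn; exists `|c|%N.
  by rewrite absz_gt0; apply: contra_notN Pc => /eqP->.
move=> p p_prime pc; exists 'F_p, intr; split.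
- by rewrite pchar_Fp_0.
- move=> x Px; suff -> : x = 0 by rewrite rmorph0.
  apply/eqP; apply: contrapT => /negP x0; apply: (Pn `|x|%N).
    by rewrite absz_gt0.
  by rewrite natz abszEsg; apply: PM.
- apply: contra pc => /eqP c0; rewrite (dvdn_pcharf (pchar_Fp p_prime)) pmulrn.
  by rewrite abszEsg rmorphM /= c0 mulr0.
Qed.

(** The passage from R to R[X]. Let b be the class of X in R[X]/P, and Q the
    trace of P on R, so that R[X]/P is generated by b over the domain R/Q. *)
Section PolynomialStep.
Variables (R : idomainType) (P : set {poly R}).
Hypothesis primeP : prime_ideal P.

Let idP : ideal P. Proof. by case: primeP. Qed.
Let Q : set R := [set r | P r%:P].

Lemma prime_ideal_contraction : prime_ideal Q.
Proof.
have [_ P1 PP] := primeP; have [P0 _ _] := idP; split=> [||x y]; first split.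
- by rewrite /Q /= polyC0.
- by move=> x y; rewrite /Q /= polyCD; apply: ideal_add.
- by move=> a x; rewrite /Q /= polyCM; apply: ideal_mull.
- by rewrite /Q /= polyC1.
- by rewrite /Q /= polyCM; apply: PP.
Qed.

Let inQX (h : {poly R}) := forall i, Q h`_i.

Let QX_sub (h : {poly R}) : inQX h -> P h.
Proof.
move=> kh; rewrite -[h]coefK poly_def.
apply: big_ind => [|x y|i _]; [by case: idP|exact: ideal_add|].
by rewrite -mul_polyC; apply: (ideal_mulr _ idP); apply: kh.
Qed.

Let inQX_add (h k : {poly R}) : inQX h -> inQX k -> inQX (h + k).
Proof.
have [idQ _ _] := prime_ideal_contraction.
by move=> hQ kQ i; rewrite coefD; apply: (ideal_add idQ).
Qed.

Let drop_lead (h : {poly R}) : h != 0 -> Q (lead_coef h) ->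
  exists2 g : {poly R}, (size g < size h)%N & inQX (h - g).
Proof.
have [idQ _ _] := prime_ideal_contraction.
move=> h0 Ql; have sh : (0 < size h)%N by rewrite size_poly_gt0.
exists (h - (lead_coef h)%:P * 'X^((size h).-1)).
  rewrite -[ltnRHS](prednK sh) ltnS; apply/leq_sizeP => j.
  rewrite coefB coefCM coefXn leq_eqVlt => /predU1P[<-|ltj].
    by rewrite eqxx mulr1 subrr.
  by rewrite gtn_eqF // mulr0 subr0 nth_default // -(prednK sh).
by rewrite opprB addrC subrK => i; rewrite coefCM; apply: (ideal_mulr _ idQ).
Qed.

(** The case where b is algebraic over R/Q: f is an annihilating polynomial of
    least degree, so it is irreducible over the fraction field. By minimality,
    pseudo-division of an element of P by f leaves a remainder in Q[X]. *)
Section Algebraic.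
Variable f : {poly R}.
Hypotheses (Pf : P f) (Qf : ~ Q (lead_coef f)).
Hypothesis f_min : forall h, P h -> (size h < size f)%N -> inQX h.

Let f_neq0 : f != 0.
Proof.
by apply: contra_not_neq Qf => ->; rewrite lead_coef0 /Q /= polyC0; case: idP.
Qed.

(** As f is irreducible over the fraction field of R/Q, the class of d is
    invertible there; the Euclidean algorithm, with pseudo-divisions, yields a
    multiple of d that is a nonzero constant modulo P. *)
Let bezout_small m (d : {poly R}) :
  (size d <= m)%N -> (size d < size f)%N -> ~ P d ->
  exists v : {poly R}, exists r, ~ Q r /\ P (v * d - r%:P).
Proof.
have [idQ _ QM] := prime_ideal_contraction.
elim: m d => [|m IHm] d.
  by rewrite leqn0 size_poly_eq0 => /eqP-> _ []; case: idP.
move=> sdm sdf Pd.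
have d0 : d != 0 by apply: contra_not_neq Pd => ->; case: idP.
have [Qd|Qd] := pselect (Q (lead_coef d)).
  have [g gd /QX_sub Pdg] := drop_lead d0 Qd.
  have [|||v [r [Qr Pr]]] := IHm g.
  - by rewrite -ltnS (leq_trans gd).
  - exact: ltn_trans sdf.
  - by move=> Pg; apply: Pd; rewrite -(subrK g d); apply: ideal_add.
  exists v, r; split=> //.
  by have := ideal_add idP Pr (ideal_mull v idP Pdg); congr (P _); ring.
have [sd1|sd1] := leqP (size d) 1.
  exists 1, (lead_coef d); split=> //; rewrite mul1r /lead_coef.
  rewrite (size1_polyC sd1) size_polyC.
  by case: eqP => [->|_]; rewrite coefC /= ?polyC0 subrr; case: idP.
have e := Pdiv.Idomain.divp_eq f d; rewrite -mul_polyC in e.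
have srd : (size (f %% d)%R < size d)%N by rewrite Pdiv.CommonIdomain.ltn_modp.
set l := lead_coef d ^+ _ in e; have Ql : ~ Q l.
  rewrite {e}/l; elim: (X in _ ^+ X) => [|k IHk].
    by case: prime_ideal_contraction.
  by rewrite exprS => /QM[].
have [Pr|Pr] := pselect (P (f %% d)).
  have Pq : P (f %/ d).
    have [_ _ PM] := primeP; case: (PM (f %/ d) d) => //.
    have := ideal_sub idP (ideal_mull l%:P idP Pf) Pr.
    by rewrite e; congr (P _); ring.
  have kr := f_min Pr (ltn_trans srd sdf).
  have kq : inQX (f %/ d).
    apply: f_min => //; rewrite size_divp // ltn_subrL.
    by rewrite -subn1 subn_gt0 sd1 (leq_ltn_trans _ sdf).
  have [] := QM l (lead_coef f) => //.
  rewrite /lead_coef -coefCM e coefD; apply: (ideal_add idQ) => //.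
  rewrite coefM; apply: big_ind => [|x y|i _]; first by case: idQ.
    exact: ideal_add.
  exact: (ideal_mulr _ idQ).
have [||v [r [Qr Pv]]] := IHm _ _ _ Pr.
- by rewrite -ltnS (leq_trans srd).
- exact: ltn_trans sdf.
exists (- v * (f %/ d)), r; split=> //.
have := ideal_sub idP Pv (ideal_mull (v * l%:P) idP Pf).
by rewrite -mulrA e; congr (P _); ring.
Qed.

Let pow_lead n : ~ Q (lead_coef f ^+ n).
Proof.
have [_ Q1 QM] := prime_ideal_contraction.
by elim: n => [|n IHn] //; rewrite exprS => /QM[].
Qed.

Let bezout c : ~ P c ->
  exists v : {poly R}, exists r, ~ Q r /\ P (v * c - r%:P).
Proof.
move=> Pc; have e := Pdiv.Idomain.divp_eq c f; rewrite -mul_polyC in e.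
set l := lead_coef f ^+ _ in e; have Ql : ~ Q l by apply: pow_lead.
have [|||v [r [Qr Pr]]] := @bezout_small (size (c %% f)%R) (c %% f) => //.
- by rewrite Pdiv.CommonIdomain.ltn_modp.
- move=> Pr; have [_ _ PM] := primeP; case: (PM l%:P c) => //.
  by rewrite e; apply: ideal_add => //; apply: ideal_mull.
exists (v * l%:P), r; split=> //.
have := ideal_add idP Pr (ideal_mull (v * (c %/ f)) idP Pf).
by rewrite -mulrA e; congr (P _); ring.
Qed.

(** A point psi of R/Q at which neither the leading coefficient of f nor the
    constant r obtained from c vanishes extends to R[X]/P: send X to a root of
    the image of f. Then c is invertible at the extended point. *)
Lemma extend_algebraic c : ~ P c -> exists2 r, ~ Q r &
  forall (F : finFieldType) (psi : {rmorphism R -> F}),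
    (forall x, Q x -> psi x = 0) -> psi r != 0 ->
  exists (F' : finFieldType) (iota : {rmorphism F -> F'})
         (psi' : {rmorphism {poly R} -> F'}),
    (forall x, P x -> psi' x = 0) /\ psi' c != 0.
Proof.
have [idQ _ QM] := prime_ideal_contraction.
move=> /bezout[v [r [Qr Pv]]]; exists (r * lead_coef f); first by move=> /QM[].
move=> F psi psiQ; rewrite rmorphM mulf_eq0 negb_or => /andP[r0 l0].
have sf : (1 < size (map_poly psi f))%N.
  rewrite size_map_poly_id0 // ltnNge; apply/negP => sf1; apply: Qf.
  by rewrite (size1_polyC sf1) lead_coefC /Q /= -size1_polyC.
have [F' [iota [w]]] := root_finite_extension sf.
rewrite -map_poly_comp => fw0.
pose psi' : {rmorphism {poly R} -> F'} :=
  horner_morph (fun x => mulrC w ((iota \o psi) x)).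
have psi'f : psi' f = 0 by apply/rootP.
have psi'C x : psi' x%:P = iota (psi x) by rewrite /= horner_morphC.
have psi'P x : P x -> psi' x = 0.
  move=> Px; have e := Pdiv.Idomain.divp_eq x f; rewrite -mul_polyC in e.
  have kr : inQX (x %% f).
    apply: f_min; last by rewrite Pdiv.CommonIdomain.ltn_modp.
    have := ideal_sub idP (ideal_mull (lead_coef f ^+ scalp x f)%:P idP Px)
      (ideal_mull (x %/ f) idP Pf).
    by rewrite e; congr (P _); ring.
  have r00 : psi' (x %% f) = 0.
    rewrite /= /horner_morph (_ : map_poly _ _ = 0) ?horner0 //.
    by apply/polyP => i; rewrite coef_map coef0 /= psiQ // rmorph0.
  move/(congr1 psi'): e; rewrite rmorphD !rmorphM psi'f r00 mulr0 addr0 => /eqP.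
  rewrite mulf_eq0 psi'C fmorph_eq0 rmorphXn expf_eq0 (negPf l0) andbF.
  by move=> /eqP.
exists F', iota, psi'; split=> //.
apply: contra_neq r0 => c0; apply/eqP; rewrite -(fmorph_eq0 iota) -psi'C.
have := psi'P _ Pv; rewrite rmorphB rmorphM c0 mulr0 sub0r => /eqP.
by rewrite oppr_eq0.
Qed.

End Algebraic.

(** Either b is transcendental over R/Q, and X can be sent to any element at
    which the image of c does not vanish, or b is algebraic. *)
Lemma extend_to_poly c : ~ P c -> exists2 r, ~ Q r &
  forall (F : finFieldType) (psi : {rmorphism R -> F}),
    (forall x, Q x -> psi x = 0) -> psi r != 0 ->
  exists (F' : finFieldType) (iota : {rmorphism F -> F'})
         (psi' : {rmorphism {poly R} -> F'}),
    (forall x, P x -> psi' x = 0) /\ psi' c != 0.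
Proof.
move=> Pc.
have [allk|] := pselect (forall h, P h -> inQX h).
  have /existsNP[i Qi] : ~ inQX c by move/QX_sub.
  exists c`_i => // F psi psiQ ci.
  have c0 : map_poly psi c != 0.
    by apply: contra_neq ci => c0; rewrite -coef_map c0 coef0.
  (* A root w of X c - 1 is an element at which c does not vanish. *)
  have sq : (1 < size ('X * map_poly psi c - 1)%R)%N.
    have s1 : (1 < size ('X * map_poly psi c)%R)%N.
      by rewrite mulrC size_mulX // ltnS size_poly_gt0.
    by rewrite size_polyDl // size_polyN size_poly1.
  have [F' [iota [w]]] := root_finite_extension sq.
  rewrite rmorphB rmorphM rmorph1 /= map_polyX -map_poly_comp => /rootP.
  rewrite hornerD hornerN hornerC hornerM hornerX => /eqP.
  rewrite subr_eq0 => w1.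
  pose psi' : {rmorphism {poly R} -> F'} :=
    horner_morph (fun x => mulrC w ((iota \o psi) x)).
  exists F', iota, psi'; split=> [x /allk kx|]; last first.
    apply: contraL w1 => /eqP; rewrite /psi' /= /horner_morph => ->.
    by rewrite mulr0 eq_sym oner_eq0.
  rewrite /= /horner_morph (_ : map_poly _ _ = 0) ?horner0 //.
  by apply/polyP => j; rewrite coef_map coef0 /= psiQ // rmorph0.
move=> /existsNP[h0 /not_implyP[Ph0 kh0]].
have Sex : exists n, `[< exists h, [/\ P h, ~ inQX h & size h = n] >].
  by exists (size h0); apply/asboolP; exists h0.
case: (ex_minnP Sex) => n /asboolP[f [Pf kf <-]] fmin.
have f_min h : P h -> (size h < size f)%N -> inQX h.
  move=> Ph; apply: contraPP => kh; apply/negP; rewrite -leqNgt.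
  by apply: fmin; apply/asboolP; exists h.
have f0 : f != 0.
  apply: contra_not_neq kf => -> i; rewrite coef0 /Q /= polyC0.
  by case: idP.
apply: (extend_algebraic Pf) => // Ql.
have [g gf gfQ] := drop_lead f0 Ql; apply: kf.
rewrite -(subrK g f); apply: inQX_add => //; apply: f_min => //.
by rewrite -[g](subKr f); apply: ideal_sub => //; apply: QX_sub.
Qed.

End PolynomialStep.

Lemma has_residue_fields_poly (R : idomainType) :
  has_residue_fields R -> has_residue_fields {poly R}.
Proof.
move=> resR P c primeP Pc Pn; have [r Qr ext] := extend_to_poly primeP Pc.
have primeQ := prime_ideal_contraction primeP.
have [|N N0 Np] := resR _ _ primeQ Qr.
  by move=> n n0; rewrite /= rmorph_nat; apply: Pn.
exists N => // p p_prime /Np[//|F [psi [p0 psiQ psir]]].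
have [F' [iota [psi' [psiP psic]]]] := ext F psi psiQ psir.
by exists F', psi'; split=> //; rewrite -(rmorph_nat iota) p0 rmorph0.
Qed.

(** R is a polynomial ring over the integers with one variable for each entry
    of s. *)
Lemma finitely_generated_cover (B : comNzRingType) (s : seq B) :
  exists (R : idomainType) (f : {rmorphism R -> B}),
    [/\ noetherian R, has_residue_fields R &
        forall b, b \in s -> exists x, f x = b].
Proof.
elim: s => [|b s [R [f [noethR resR fs]]]].
  exists int, intr; split=> //; first exact: noetherian_int.
  exact: has_residue_fields_int.
exists {poly R}, (horner_morph (fun x => mulrC b (f x))).
split; [exact: noetherian_poly | exact: has_residue_fields_poly |] => c.
rewrite inE => /predU1P[->|/fs[x <-]].
  by exists 'X; rewrite /= horner_morphX.
by exists x%:P; rewrite /= horner_morphC.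
Qed.

(** * Endomorphisms of finite order *)

Section Endomorphisms.
Variable B : comPzRingType.
Implicit Types (g : B -> B) (J N : set B).

Definition ring_endo g : Prop :=
  [/\ {morph g : x y / x + y}, {morph g : x y / x * y} & g 1 = 1].

Lemma ring_endo_iter g n : ring_endo g -> ring_endo (iter n g).
Proof.
move=> [gD gM g1]; split=> [x y|x y|]; elim: n => //= n IHn; first 2 last.
- by rewrite IHn.
- by rewrite IHn gD.
by rewrite IHn gM.
Qed.

Lemma ring_endoB g : ring_endo g -> {morph g : x y / x - y}.
Proof.
by move=> [gD _ _] x y; apply: (addIr (g y)); rewrite -gD !subrK.
Qed.

Lemma iter_congruent_id g N n b : ideal N ->
  (forall b, N (g b - b)) -> N (iter n g b - b).
Proof.
move=> idN gN; elim: n => [|n IHn] /=; first by rewrite subrr; case: idN.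
by have := ideal_add idN (gN (iter n g b)) IHn; rewrite addrA subrK.
Qed.

(** With D the ideal generated by (g - 1)B and E = JD: the condition on g gives
    (g - 1)(J^2) <= E by the Leibniz-like formula
    g(ab) - ab = (g a - a) g b + a (g b - b), hence (g - 1)^2 B <= E and
    g^k = 1 + k(g - 1) modulo E. For k = n this shows n(g - 1)B <= E; since p
    lies in J, also p(g - 1)B <= E, so that D = JD. *)
Lemma coprime_order_congr g n p J : noetherian B -> ring_endo g -> ideal J ->
    (0 < n)%N -> iter n g =1 id -> coprime n p -> J p%:R ->
    (forall b, mul_ideal J J (g b - b)) ->
  exists2 j, J j & forall b, (1 - j) * (g b - b) = 0.
Proof.
move=> noethB endo_g idJ n_gt0 gn1 np Jp gJJ.
have [gD gM g1] := endo_g; have gB := ring_endoB endo_g.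
have g0 : g 0 = 0 by rewrite -(subrr 1) gB !subrr.
pose D := smallest ideal [set g b - b | b in setT].
have idD : ideal D by apply: ideal_smallest.
have Dg b : D (g b - b) by apply: sub_gen_smallest; exists b.
pose E := mul_ideal J D; have idE : ideal E by apply: ideal_mul.
have gJ b : J (g b - b) by apply: mul_ideal_subl (gJJ b).
have Jg x : J x -> J (g x).
  by move=> Jx; rewrite -(subrK x (g x)); apply: ideal_add.
pose I' := [set x | J x /\ E (g x - x)].
have idI' : ideal I'.
  split=> [|x y [Jx Ex] [Jy Ey]|a x [Jx Ex]].
  - by rewrite /I' /= g0 subr0; split; [case: idJ | case: idE].
  - split; first exact: ideal_add.
    by have := ideal_add idE Ex Ey; rewrite gD; congr (E _); ring.
  split; first exact: ideal_mull.
  have := ideal_add idE (mul_idealP (Jg _ Jx) (Dg a)) (ideal_mull a idE Ex).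
  by rewrite gM; congr (E _); ring.
have JJI' x : mul_ideal J J x -> I' x.
  apply: smallest_sub => // _ [a [b [Ja Jb ->]]].
  split; first exact: ideal_mull.
  have := ideal_add idE (mul_idealP (Jg _ Jb) (Dg a)) (mul_idealP Ja (Dg b)).
  by rewrite gM; congr (E _); ring.
have iterE k b : E (iter k g b - b - (g b - b) *+ k).
  elim: k => [|k IHk]; first by rewrite subrr sub0r mulr0n oppr0; case: idE.
  have [_ E1] : I' (iter k g b - b).
    by apply: JJI'; apply: (iter_congruent_id _ _ (ideal_mul J J)).
  have := ideal_add idE IHk E1.
  by rewrite gB /= mulrS; congr (E _); ring.
have DE b : E (g b - b).
  apply: (coprime_ideal idE n_gt0 np).
    rewrite -[_ *+ n]opprK; apply: (ideal_opp idE).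
    by have := iterE n b; rewrite gn1 subrr sub0r.
  by rewrite -mulr_natl; apply: mul_idealP.
have DsubE x : D x -> E x by apply: smallest_sub => // _ [b _ <-].
have [s Ds] := noethB _ idD.
have [||e Je es0] := @nakayama _ J s 1 idJ.
- by rewrite subrr; case: idJ.
- by rewrite -Ds => x; rewrite mul1r; apply: DsubE.
exists (1 - e) => // b; rewrite opprB addrC subrK; apply: es0; rewrite -Ds.
exact: Dg.
Qed.

(** The order of g is n = m a with a a power of p and m prime to p. The power
    g^a has order prime to p and g^m has order prime to q, so the preceding
    lemma applies to g^a and J, and to g^m and K. The exponents a and m are
    coprime, so g itself is congruent to 1 modulo the ideal T of all elements
    that are annihilated by some (1 - j)(1 - k). As T is finitely generated, a
    single product annihilates it. *)
Lemma torsion_congruence_annihilated p q J K :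
    noetherian B -> prime p -> prime q -> p != q ->
    ideal J -> ideal K -> J p%:R -> K q%:R ->
  exists j k, [/\ J j, K k & forall g n, ring_endo g -> (0 < n)%N ->
    iter n g =1 id -> (forall b, (mul_ideal J J `&` mul_ideal K K) (g b - b)) ->
    forall b, (1 - j) * (1 - k) * (g b - b) = 0].
Proof.
move=> noethB p_prime q_prime neq_pq idJ idK Jp Kq.
have circ (I : set B) (i j : B) : ideal I -> I i -> I j -> I (i + j - i * j).
  move=> idI Ii Ij; apply: ideal_sub => //; first exact: ideal_add.
  exact: ideal_mull.
have circE (i j k l x : B) : (1 - (i + j - i * j)) * (1 - (k + l - k * l)) * x =
    (1 - i) * (1 - k) * ((1 - j) * (1 - l) * x) by ring.
pose T := [set x | exists j k, [/\ J j, K k & (1 - j) * (1 - k) * x = 0]].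
have idT : ideal T.
  split=> [|x y [i [k [Ji Kk x0]]] [j [l [Jj Kl y0]]]|a x [i [k [Ji Kk x0]]]].
  - by exists 0, 0; rewrite mulr0; split=> //; [case: idJ | case: idK].
  - exists (i + j - i * j), (k + l - k * l); split.
    + exact: circ.
    + exact: circ.
    by rewrite circE [_ * (x + y)]mulrDr y0 addr0 mulrCA x0 mulr0.
  by exists i, k; split=> //; rewrite mulrCA x0 mulr0.
have [t Tt] := noethB _ idT.
have [j [k [Jj Kk jkT]]] : exists j k,
    [/\ J j, K k & forall x, T x -> (1 - j) * (1 - k) * x = 0].
  have tT : [set` t] `<=` T by rewrite Tt; apply: sub_gen_smallest.
  suff [j [k [Jj Kk jkt]]] : exists j k,
      [/\ J j, K k & forall x, x \in t -> (1 - j) * (1 - k) * x = 0].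
    exists j, k; split=> // x; rewrite Tt; move: x; apply: smallest_sub => //.
    split=> [|x y x0 y0|a x x0] /=; first by rewrite mulr0.
      by rewrite mulrDr x0 y0 addr0.
    by rewrite mulrCA x0 mulr0.
  elim: t {Tt} tT => [|x t IHt] tT.
    by exists 0, 0; split=> //; [case: idJ | case: idK].
  have [|i [l [Ji Kl il]]] := IHt.
    by move=> y yt; apply: tT; rewrite /= inE yt orbT.
  have [|j [k [Jj Kk jkx]]] := tT x; first by rewrite /= inE eqxx.
  exists (i + j - i * j), (l + k - l * k); split.
  + exact: circ.
  + exact: circ.
  move=> y; rewrite inE circE => /predU1P[->|/il y0].
    by rewrite jkx mulr0.
  by rewrite mulrCA y0 mulr0.
exists j, k; split=> // g n endo_g n0 gn1 gJK b; apply: jkT.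
have idJJ := ideal_mul J J; have idKK := ideal_mul K K.
have [m pm nm] := pfactor_coprime p_prime n0.
have m0 : (0 < m)%N by move: n0; rewrite nm muln_gt0 => /andP[].
pose a := (p ^ logn p n)%N; have a0 : (0 < a)%N by rewrite expn_gt0 prime_gt0.
have iterJ i c : mul_ideal J J (iter i g c - c).
  by apply: (iter_congruent_id _ _ idJJ) => d; case: (gJK d).
have iterK i c : mul_ideal K K (iter i g c - c).
  by apply: (iter_congruent_id _ _ idKK) => d; case: (gJK d).
have Ta c : T (iter a g c - c).
  have [||i Ji iP] := @coprime_order_congr (iter a g) m p J noethB
    (ring_endo_iter a endo_g) idJ m0 _ _ Jp (iterJ a).
  - by move=> d; rewrite -iterM -nm gn1.
  - by rewrite coprime_sym.
  exists i, 0; split=> //; first by case: idK.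
  by rewrite subr0 mulr1 iP.
have Tm c : T (iter m g c - c).
  have [||i Ki iP] := @coprime_order_congr (iter m g) a q K noethB
    (ring_endo_iter m endo_g) idK a0 _ _ Kq (iterK m).
  - by move=> d; rewrite -iterM mulnC -nm gn1.
  - by rewrite coprimeXl // prime_coprime // dvdn_prime2.
  exists 0, i; split=> //; first by case: idJ.
  by rewrite subr0 mul1r iP.
have /(coprimeP m a0)[[u v] /= uv1] : coprime a m by rewrite coprimeXl.
have Tu : T (iter (u * a) g b - b).
  rewrite iterM; apply: (iter_congruent_id _ _ idT) => c.
  exact: Ta.
have Tv : T (iter (v * m) g (g b) - g b).
  rewrite iterM; apply: (iter_congruent_id _ _ idT) => c.
  exact: Tm.
have uv : (u * a = v * m + 1)%N by lia.
have := ideal_sub idT Tu Tv.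
by rewrite uv iterD /=; congr (T _); ring.
Qed.

End Endomorphisms.

Section FinitelyGeneratedRing.
Variables (B : comNzRingType) (s : seq B).
Hypothesis sB : forall b, smallest subring [set` s] b.

Let surjective_cover (R : comNzRingType) (f : {rmorphism R -> B}) :
  (forall b, b \in s -> exists x, f x = b) -> forall b, exists x, f x = b.
Proof.
move=> fs b; suff : smallest subring [set` s] `<=` [set b | exists x, f x = b].
  by apply; apply: sB.
apply: smallest_sub => //.
split=> [|_ _ [x <-] [y <-]|_ _ [x <-] [y <-]].
- by exists 1; rewrite rmorph1.
- by exists (x - y); rewrite rmorphB.
- by exists (x * y); rewrite rmorphM.
Qed.

Lemma noetherian_finitely_generated : noetherian B.
Proof.
have [R [f [noethR _ /surjective_cover fsurj]]] := finitely_generated_cover s.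
exact: noetherian_image noethR fsurj.
Qed.

(** J and K are the kernels of two points, over finite fields of different
    characteristics, of B/P where P is a prime ideal containing N but no
    positive integer. If (1 - j)(1 - k) lay in N, then 1 - j or 1 - k would lie
    in P and vanish at the corresponding point, where its value is 1. *)
Lemma exists_residue_ideals (N : set B) :
    ideal N -> (forall n, (0 < n)%N -> ~ N n%:R) ->
  exists p q J K, [/\ prime p, prime q & p != q] /\
    [/\ ideal J, finite_index J & J p%:R] /\
    [/\ ideal K, finite_index K & K q%:R] /\
    forall j k, J j -> K k -> ~ N ((1 - j) * (1 - k)).
Proof.
move=> idN Nn.
have [R [f [_ resR /surjective_cover fsurj]]] := finitely_generated_cover s.
pose M := [set x : R | exists2 n, (0 < n)%N & x = n%:R].
pose N' := [set x | N (f x)].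
have idN' : ideal N'.
  split=> [|x y|a x]; rewrite /N' /= ?rmorph0 ?rmorphD ?rmorphM.
  - by case: idN.
  - exact: ideal_add.
  - exact: ideal_mull.
have [|||P [primeP NP PM]] := @exists_prime_ideal _ N' M idN'.
- by exists 1%N.
- move=> _ _ [m m0 ->] [n n0 ->]; exists (m * n)%N; rewrite ?natrM //.
  by rewrite muln_gt0 m0.
- by move=> x N'x [n n0 xn]; apply: (Nn n n0); rewrite -(rmorph_nat f) -xn.
have [idP P1 PP] := primeP.
have [|r r0 resr] := resR P 1 primeP P1.
  by move=> n n0 Pn; apply: (PM n%:R) => //; exists n.
have point p : prime p -> ~~ (p %| r)%N ->
    exists J, [/\ ideal J, finite_index J, J p%:R &
      forall x, J (f x) -> exists2 y, f x = f y & ~ P (1 - y)].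
  move=> p_prime /(resr _ p_prime)[F [psi [p0 psiP psi1]]].
  exists [set f x | x in [set x | psi x = 0]]; split.
  - split=> [|_ _ [x x0 <-] [y y0 <-]|a _ [x x0 <-]].
    + by exists 0; rewrite /= rmorph0.
    + by exists (x + y); rewrite /= rmorphD // x0 y0 addr0.
    + have [y <-] := fsurj a.
      by exists (y * x); rewrite /= rmorphM // x0 mulr0.
  - have /choice[h hP] := fsurj.
    exists F, (psi \o h) => x y /= exy; exists (h x - h y).
      by rewrite /= rmorphB exy subrr.
    by rewrite rmorphB !hP.
  - by exists p%:R; rewrite /= rmorph_nat.
  - move=> x [y /= y0 <-]; exists y => // /psiP/eqP.
    by rewrite rmorphB rmorph1 y0 subr0 oner_eq0.
have large k : exists p, [/\ prime p, ~~ (p %| r)%N & (k < p)%N].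
  have [p p_gt p_prime] := prime_above (maxn k r).
  exists p; split=> //; last by rewrite (leq_ltn_trans _ p_gt) // leq_maxl.
  apply/negP => /(dvdn_leq r0).
  by rewrite leqNgt (leq_ltn_trans _ p_gt) // leq_maxr.
have [p [p_prime pr _]] := large 0%N.
have [q [q_prime qr ltpq]] := large p.
have [J [idJ fiJ Jp JP]] := point p p_prime pr.
have [K [idK fiK Kq KP]] := point q q_prime qr.
exists p, q, J, K; split; first by rewrite ltn_eqF.
do 2!split=> //; move=> j k Jj Kk.
have [x xj] := fsurj j; have [y yk] := fsurj k; rewrite -xj -yk in Jj Kk *.
have [x' -> Px] := JP _ Jj; have [y' -> Py] := KP _ Kk => Nxy.
case: (PP (1 - x') (1 - y')) => //; apply: NP.
by rewrite /N' /= rmorphM !rmorphB rmorph1.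
Qed.

Hypothesis torsfree : forall n (b : B), (0 < n)%N -> b *+ n = 0 -> b = 0.

(** The automorphism group of B is virtually torsion-free: the congruence
    subgroup modulo J contains no element of finite order but the identity. *)
Lemma torsion_congruence_trivial :
  exists J : set B, [/\ ideal J, finite_index J &
    forall g n, ring_endo g -> (0 < n)%N -> iter n g =1 id ->
      (forall b, J (g b - b)) -> g =1 id].
Proof.
have noethB := noetherian_finitely_generated.
pose kills (x : B) (J : set B) := forall g n,
  ring_endo g -> (0 < n)%N -> iter n g =1 id ->
  (forall b, J (g b - b)) -> forall b, x * (g b - b) = 0.
pose N : set B := [set x | exists J, [/\ ideal J, finite_index J & kills x J]].
have idN : ideal N.
  split=> [|x y [J [idJ fiJ xJ]] [K [idK fiK yK]]|a x [J [idJ fiJ xJ]]].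
  - exists setT; split=> //; last by move=> ? ? _ _ _ _ b; rewrite mul0r.
    by exists unit, (fun=> tt).
  - exists (J `&` K); split; [exact: ideal_setI | exact: finite_index_setI |].
    move=> g n endo_g n0 gn1 gJK b; rewrite mulrDl.
    rewrite (xJ g n) ?(yK g n) ?addr0 // => c; by have [] := gJK c.
  exists J; split=> // g n endo_g n0 gn1 gJ b.
  by rewrite -mulrA (xJ g n) ?mulr0.
suff [J [idJ fiJ J1]] : N 1.
  exists J; split=> // g n endo_g n0 gn1 gJ b.
  by apply/eqP; rewrite -subr_eq0 -[_ - _]mul1r (J1 g n).
apply: contrapT => N1.
have [n n0 [J [idJ fiJ nJ]]|] := @exists_residue_ideals N idN.
  apply: N1; exists J; split=> // g m endo_g m0 gm1 gJ b; rewrite mul1r.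
  by apply: (torsfree n0); rewrite -mulr_natl (nJ g m).
move=> p [q [J [K [[p_prime q_prime neq_pq]]]]].
move=> [[idJ fiJ Jp] [[idK fiK Kq] JKN]].
have [j [k [Jj Kk jkT]]] :=
  torsion_congruence_annihilated noethB p_prime q_prime neq_pq idJ idK Jp Kq.
apply: (JKN j k) => //; exists (mul_ideal J J `&` mul_ideal K K); split=> //.
  by apply: ideal_setI; apply: ideal_mul.
by apply: finite_index_setI; apply: finite_index_sqr.
Qed.

(** Map g to the classes modulo J of its values on s. If g and h have the same
    image they are congruent modulo J, hence so are g h^-1 and the identity. The
    inverse of h is the power of h with exponent the order minus one, so it
    belongs to K up to the identity map. *)
Lemma finite_torsion_action (K : set (B -> B)) :
    (forall g, K g -> ring_endo g) ->
    (forall g h, K g -> K h -> K (g \o h)) ->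
    (forall g, K g -> exists2 n, (0 < n)%N & iter n g =1 id) ->
  finite_set K.
Proof.
move=> Kendo Kcomp Ktors.
have [J [idJ [F [c cP]] Jtriv]] := torsion_congruence_trivial.
pose col g := map_tuple (c \o g) (in_tuple s).
have col_inj : {in K &, injective col}.
  move=> g h; rewrite !inE => Kg Kh /(congr1 val)/= /eq_in_map gh.
  have [n n_gt0 hn] := Ktors h Kh.
  have [gD gM g1] := Kendo _ Kg; have [hD hM h1] := Kendo _ Kh.
  have Jgh b : J (g b - h b).
    suff : smallest subring [set` s] `<=` [set b | J (g b - h b)].
      by apply; apply: sB.
    apply: smallest_sub => [|b' bs]; last by apply: cP; apply: gh.
    split=> [|x y|x y] /=; first by rewrite g1 h1 subrr; case: idJ.
      rewrite (ring_endoB (Kendo _ Kg)) (ring_endoB (Kendo _ Kh)) => Jx Jy.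
      by have := ideal_sub idJ Jx Jy; congr (J _); ring.
    rewrite gM hM => Jx Jy.
    have := ideal_add idJ (ideal_mull (g y) idJ Jx) (ideal_mull (h x) idJ Jy).
    by congr (J _); ring.
  have hK b : iter n.-1 h (h b) = b by rewrite -iterSr prednK // hn.
  have hK' b : h (iter n.-1 h b) = b by rewrite -iterS prednK // hn.
  have Kpow m : K (h \o iter m h).
    by elim: m => [|m IHm] /=; [|apply: (Kcomp h _ Kh IHm)].
  have Kgh : K (g \o iter n.-1 h).
    case: n.-1 => [|m] //=; exact: (Kcomp g _ Kg (Kpow m)).
  have [m m_gt0 ghm] := Ktors _ Kgh.
  have gh1 := Jtriv _ m (Kendo _ Kgh) m_gt0 ghm.
  apply/funext => b; rewrite -{1}(hK b); apply: gh1 => d /=.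
  by rewrite -{2}(hK' d).
rewrite -(eq_finite_set (inj_card_eq col_inj)).
exact: finite_finset.
Qed.

End FinitelyGeneratedRing.

(** * Descent to a finitely generated ring *)

Section SubringType.
Variables (A : comPzRingType) (C : set A).

(** The proofs are parameters of the type so that the ring structures below can
    be attached to it. *)
Definition subring_sort of subring C & (1 : A) <> 0 := {x : A | `[< C x >]}.

Hypotheses (subringC : subring C) (nz : (1 : A) <> 0).
Let P : {pred A} := fun x => `[< C x >].

Let subringP : subring_closed P.
Proof.
have [C1 CB CM] := subringC.
by split=> [|x y /asboolP Cx /asboolP Cy|x y /asboolP Cx /asboolP Cy];
  apply/asboolP; auto.
Qed.

Let T := subring_sort subringC nz.
HB.instance Definition _ := [isSub of T for @sval A P].
HB.instance Definition _ := [Choice of T by <:].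
HB.instance Definition _ :=
  GRing.SubChoice_isSubComPzRing.Build A P T subringP.
Let oneT_neq0 : (1 : T) != 0.
Proof. by apply/eqP => /(congr1 val); apply: nz. Qed.
HB.instance Definition _ := GRing.PzSemiRing_isNonZero.Build T oneT_neq0.

Lemma subring_comNzRing : exists (B : comNzRingType) (v : {rmorphism B -> A}),
  injective v /\ forall x, C x <-> exists b, v b = x.
Proof.
exists T, (val : {rmorphism T -> A}); split=> [|x]; first exact: val_inj.
split=> [Cx|[b <-]]; last by apply/asboolP; apply: (valP b).
have Px : P x by apply/asboolP.
by exists (exist _ x Px).
Qed.

End SubringType.

Section Descent.
Variables (Phi : comPzRingType) (A : comAlg Phi).

Definition with_scalars (s : seq A) (cs : seq Phi) : seq A :=
  s ++ [seq c *: (1 : A) | c <- cs].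

Lemma with_scalars_mono s cs cs' x : {subset cs <= cs'} ->
  smallest subring [set` with_scalars s cs] x ->
  smallest subring [set` with_scalars s cs'] x.
Proof.
move=> cscs'; apply: smallest_subring_mono => y /=; rewrite !mem_cat.
case/orP=> [->//|/mapP[c /cscs' cc' ->]].
by rewrite (map_f (fun c => c *: (1 : A))) ?orbT.
Qed.

(** An element of a finitely generated algebra is a polynomial in the
    generators; cs lists its coefficients. *)
Lemma mem_subring_with_scalars s x : smallest (@subalgebra Phi A) [set` s] x ->
  exists cs, smallest subring [set` with_scalars s cs] x.
Proof.
move: x; apply: smallest_sub => [|x xs]; last first.
  by exists [::]; apply: sub_gen_smallest; rewrite /= mem_cat xs.
split=> [|c x y [cs xcs] [ds yds]|x y [cs xcs] [ds yds]].
- by exists [::]; case: (smallest_subring [set` with_scalars s [::]]).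
- exists (c :: cs ++ ds); rewrite -[x in c *: x]mul1r.
  have -> : c *: (1 * x) = (c *: (1 : A)) * x by exact: alg_scaleAl.
  apply: (subringD (smallest_subring _)).
    have [_ _ CM] := smallest_subring [set` with_scalars s (c :: cs ++ ds)].
    apply: CM.
      apply: sub_gen_smallest; rewrite /= mem_cat.
      rewrite (map_f (fun c => c *: (1 : A))) ?orbT //.
      by rewrite inE eqxx.
    by apply: with_scalars_mono xcs => d dcs; rewrite inE mem_cat dcs orbT.
  by apply: with_scalars_mono yds => d dds; rewrite inE mem_cat dds !orbT.
exists (cs ++ ds).
have [_ _ CM] := smallest_subring [set` with_scalars s (cs ++ ds)]; apply: CM.
  by apply: with_scalars_mono xcs => d dcs; rewrite mem_cat dcs.
by apply: with_scalars_mono yds => d dds; rewrite mem_cat dds orbT.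
Qed.

Lemma subset_subring_with_scalars s (l : seq A) :
  smallest (@subalgebra Phi A) [set` s] = setT ->
  exists cs, forall x, x \in l -> smallest subring [set` with_scalars s cs] x.
Proof.
move=> sT; elim: l => [|x l [cs lcs]]; first by exists [::].
have [|ds xds] := @mem_subring_with_scalars s x; first by rewrite sT.
exists (cs ++ ds) => y; rewrite inE => /predU1P[->|/lcs ycs].
  by apply: with_scalars_mono xds => d dds; rewrite mem_cat dds orbT.
by apply: with_scalars_mono ycs => d dcs; rewrite mem_cat dcs.
Qed.

Lemma algAut_expgE (g : algAut A) n x : (g ^+ n)%g x = iter n g x.
Proof. by elim: n => [|n IHn] //; rewrite expgS /= -IHn. Qed.

Lemma algAut_endo (g : algAut A) : ring_endo g.
Proof.
have [g1 gM] := aut_monoid g; split=> // x y.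
by rewrite -{1}[x]scale1r aut_linear scale1r.
Qed.

End Descent.

Theorem corollary1p2 (Phi : comPzRingType) (A : comAlg Phi)
    (Afg : finitely_generated_alg A) (Atf : no_additive_torsion A)
    (H : set (algAut A)) (Hsub : subgroup H) (Htors : torsion H) :
  locally_finite H.
Proof.
move=> K subK KH [gs Kgs]; have [s sT] := Afg.
have Ktors g : K g -> exists2 n, (0 < n)%N & iter n g =1 id.
  by move=> /KH/Htors[n n0 gn]; exists n => // x; rewrite -algAut_expgE gn.
have agree (g h : algAut A) : (forall x, x \in s -> g x = h x) -> g = h.
  move=> gh; apply: algAut_ext => x; have : setT x by [].
  rewrite -sT; move: x; apply: smallest_sub => //.
  have [[_ gM g1] [_ hM h1]] := (algAut_endo g, algAut_endo h).
  split=> [|c x y /= xE yE|x y /= xE yE]; first by rewrite /= g1 h1.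
    by rewrite !aut_linear xE yE.
  by rewrite gM hM xE yE.
(* The zero ring is treated apart: polynomials need a nontrivial ring. *)
have [A0|nz] := pselect ((1 : A) = 0).
  suff : K `<=` [set 1%g] by move=> /sub_finite_set; apply; apply: finite_set1.
  move=> g _; apply: agree => x _.
  by rewrite -[LHS]mul1r A0 mul0r -[RHS]mul1r A0 mul0r.
have [cs stab] :=
  subset_subring_with_scalars [seq (g : algAut A) x | g <- gs, x <- s] sT.
set C := smallest subring [set` with_scalars s cs] in stab.
have subC : subring C by apply: smallest_subring.
(* Linearity fixes the added scalars, so that it suffices to look at the
   generators s; inverses are powers because K is a torsion group. *)
have KC (g : algAut A) x : K g -> C x -> C (g x).
  suff KC : K `<=` [set g | K g /\ forall x, C x -> C (g x)].
    by move=> /KC[_]; apply.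
  have [K1 KM KV] := subK.
  rewrite {1}Kgs; apply: smallest_sub => [|h hgs].
    split=> [|h k [Kh hC] [Kk kC]|h [Kh hC]]; first by split.
      by split=> [|y Cy]; [exact: KM | exact: (hC _ (kC _ Cy))].
    split=> [|y Cy]; first exact: KV.
    have [n n0 hn] := Ktors h Kh.
    suff -> : (h^-1)%g = (h ^+ n.-1)%g.
      by rewrite algAut_expgE; elim: n.-1 => [|m IHm] //=; apply: hC.
    apply: (mulgI h); rewrite mulgV -expgS prednK //.
    by apply: algAut_ext => z; rewrite algAut_expgE hn.
  split; first by rewrite Kgs; apply: sub_gen_smallest.
  have [hD hM h1] := algAut_endo h; have [C1 CB CM] := subC.
  apply: smallest_sub => [|y].
    split=> [|y z Cy Cz|y z Cy Cz] /=; first by rewrite h1.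
      by rewrite (ring_endoB (algAut_endo h)); apply: CB.
    by rewrite hM; apply: CM.
  rewrite /= mem_cat => /orP[ys|/mapP[c ccs ->]].
    by apply: stab; apply: allpairs_f.
  have -> : h (c *: (1 : A)) = c *: (1 : A).
    have h0 : h 0 = 0 by apply: (addIr (h 0)); rewrite -hD !add0r.
    by rewrite -[c *: (1 : A)]addr0 aut_linear h0 h1.
  apply: sub_gen_smallest; rewrite /= mem_cat.
  by rewrite (map_f (fun c => c *: (1 : A))) ?orbT.
have [B [v [vinj vC]]] := subring_comNzRing subC nz.
have /choice[act actP] g :
    exists a : B -> B, K g -> forall b, v (a b) = g (v b).
  have [Kg|nKg] := pselect (K g); last by exists id.
  have /choice[a aP] b : exists b', v b' = g (v b).
    by apply: (vC _).1; apply: KC => //; apply: (vC _).2; exists b.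
  by exists a.
have /choice[w wP] x : exists b, C x -> v b = x.
  have [/vC[b vb]|nCx] := pselect (C x); first by exists b.
  by exists 0.
have sC x : x \in with_scalars s cs -> C x.
  by move=> xs; apply: sub_gen_smallest.
have act_inj : {in K &, injective act}.
  move=> g h; rewrite !inE => Kg Kh gh; apply: agree => x xs.
  have Cx : C x by apply: sC; rewrite mem_cat xs.
  by rewrite -(wP x Cx) -!actP // gh.
rewrite -(eq_finite_set (inj_card_eq act_inj)).
apply: (@finite_torsion_action _ (map w (with_scalars s cs))).
- move=> b; suff : C `<=` [set x | exists2 b, v b = x &
      smallest subring [set` map w (with_scalars s cs)] b].
    by move=> /(_ (v b)) []; [apply/vC; exists b | move=> b' /vinj->].
  have [B1 BB BM] := smallest_subring [set` map w (with_scalars s cs)].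
  apply: smallest_sub => [|x xs]; last first.
    exists (w x); first exact: (wP _ (sC _ xs)).
    by apply: sub_gen_smallest; apply: map_f.
  split=> [|_ _ [b1 <- ?] [b2 <- ?]|_ _ [b1 <- ?] [b2 <- ?]].
  + by exists 1; rewrite ?rmorph1.
  + by exists (b1 - b2); [rewrite rmorphB | exact: BB].
  + by exists (b1 * b2); [rewrite rmorphM | exact: BM].
- move=> n b n0 bn; apply: vinj; rewrite rmorph0; apply: (Atf n) => //.
  by rewrite -rmorphMn bn rmorph0.
- move=> _ [g Kg <-]; have [gD gM g1] := algAut_endo g.
  split=> [x y|x y|]; apply: vinj.
  + by rewrite rmorphD !actP // rmorphD gD.
  + by rewrite rmorphM !actP // rmorphM gM.
  + by rewrite actP // rmorph1 g1.
- move=> _ _ [g Kg <-] [h Kh <-]; exists (g * h)%g.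
    by have [_ KM _] := subK; apply: KM.
  apply/funext => b; apply: vinj; rewrite !actP //.
  by have [_ KM _] := subK; apply: KM.
- move=> _ [g Kg <-]; have [n n0 gn] := Ktors g Kg; exists n => // b.
  apply: vinj; rewrite -[RHS]gn; elim: n {n0 gn} => //= n IHn.
  by rewrite actP // IHn.
Qed.
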